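(* In the perfect channel-state-information case, i.e. when the precoder is $\mathbf V_L=$ the matrix of the first $S$ columns of $\mathbf V$, the MMSE receiver is equivalent to the optimum BICMB receiver, in the sense that their bit metrics agree up to a positive constant factor: there is a constant $c>0$, not depending on $\mathbf y_k$, $k$, $s$, $i$ or $b$, such that for every received vector $\mathbf y_k\in\mathbb{C}^M$, every stream $s\in\{1,\dots,S\}$, every bit position $i\in\{1,\dots,m\}$ and every bit value $b\in\{0,1\}$, $$\min_{x\in\chi_b^i}\frac{W_{ss}}{1-W_{ss}}\left|\frac{\tilde r_{k,s}}{W_{ss}}-x\right|^2\;=\;c\,\min_{x\in\chi_b^i}|r'_{k,s}-\lambda_s x|^2 ,$$ where the left side is the MMSE bit metric and the right side is $c$ times the BICMB bit metric, as defined in the context.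
   Context: Let $\mathbf H\in\mathbb{C}^{M\times N}$ have singular value decomposition $\mathbf H=\mathbf U\mathbf\Sigma\mathbf V^H$, with $\mathbf U\in\mathbb C^{M\times M}$, $\mathbf V\in\mathbb C^{N\times N}$ unitary and singular values $\lambda_1\ge\lambda_2\ge\cdots\ge 0$ on the diagonal of $\mathbf\Sigma$. Let $1\le S\le\min(N,M)$ be the number of streams and assume $\lambda_S>0$. Let $\sigma^2>0$ be the noise variance. The signal set $\chi\subseteq\mathbb C$ is finite with $|\chi|=2^m$ and is equipped with a bijective binary labeling $\{0,1\}^m\to\chi$; $\chi_b^i\subseteq\chi$ is the subset of signals whose label has value $b\in\{0,1\}$ in position $i$. The received vector at time $k$ is $\mathbf y_k=\mathbf H\mathbf V_L\mathbf x_k+\mathbf n_k\in\mathbb C^M$, with $\mathbf x_k\in\chi^S$ the transmitted vector and $\mathbf n_k\in\mathbb{C}^M$ noise. The decoder of each receiver outputs a codeword minimizing the sum of its bit metrics over all coded bits, so multiplying all bit metrics by a common positive constant does not change the decisions. BICMB (bit-interleaved coded multiple beamforming) receiver: the detector is $\mathbf U^H$, and $r'_{k,s}$ is the $s$-th entry of $\mathbf U^H\mathbf y_k$, $s=1,\dots,S$; its bit metric is $\min_{x\in\chi_b^i}|r'_{k,s}-\lambda_s x|^2$. MMSE receiver: the detector is $\mathbf G=[(\mathbf H\mathbf V_L)^H\mathbf H\mathbf V_L+\sigma^2\mathbf I]^{-1}(\mathbf H\mathbf V_L)^H$, $\tilde r_{k,s}$ is the $s$-th entry of $\mathbf G\mathbf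 y_k$, and $W_{ss}$ is the $s$-th diagonal entry of $\mathbf W=\left[\mathbf I+\sigma^2[(\mathbf H\mathbf V_L)^H\mathbf H\mathbf V_L]^{-1}\right]^{-1}$; its bit metric is $\min_{x\in\chi_b^i}\frac{W_{ss}}{1-W_{ss}}\left|\frac{\tilde r_{k,s}}{W_{ss}}-x\right|^2$. *)

(* Defs.v *)
From mathcomp Require Import all_boot all_order all_algebra.
From mathcomp Require Import finmap complex reals.

Set Implicit Arguments.
Unset Strict Implicit.
Unset Printing Implicit Defensive.

Import Order.TTheory GRing.Theory Num.Theory.

Local Open Scope ring_scope.
Local Open Scope complex_scope.
Local Open Scope sesquilinear_scope.

(* Minimum of f over a nonempty finite set. The values live in R[i], whose
   order is only partial, but the result is the usual minimum as soon as they
   are real: see min_overP. The value 0 on the empty set is a dummy. *)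
Definition min_over (R : realType) (T : finType) (A : {set T})
    (f : T -> R[i]) : R[i] :=
  if enum A is x :: s then \big[Order.min/f x]_(y <- s) f y else 0.

Lemma min_overP (R : realType) (T : finType) (A : {set T}) (f : T -> R[i]) :
  A != set0 -> {in A, forall x, f x \is Num.real} ->
  exists2 x, x \in A & min_over A f = f x /\ {in A, forall y, f x <= f y}.
Proof.
move=> A0 fr; rewrite /min_over.
have : enum A != [::] by rewrite -size_eq0 -cardE cards_eq0.
have mA y : (y \in A) = (y \in enum A) by rewrite mem_enum.
have {}fr : {in enum A, forall x, f x \is Num.real}.
  by move=> x; rewrite -mA; apply: fr.
suff H : forall s x, {in x :: s, forall z, f z \is Num.real} ->
    exists2 z, z \in x :: s & \big[Order.min/f x]_(y <- s) f y = f z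
                              /\ {in x :: s, forall y, f z <= f y}.
  case E : (enum A) => [//|x s] _; rewrite E in fr.
  have [z zs [-> le]] := H s x fr.
  exists z; first by rewrite mA E.
  by split=> // y; rewrite mA E; apply: le.
elim=> [|y s IH] x rx.
  exists x; first by rewrite mem_head.
  by rewrite big_nil; split=> // y; rewrite inE => /eqP ->.
have sub z : z \in x :: s -> z \in [:: x, y & s].
  by rewrite !inE => /orP[->|->]; rewrite ?orbT.
have ys : y \in [:: x, y & s] by rewrite !inE eqxx orbT.
have [z zs [eqz lez]] := IH x (fun z zs => rx z (sub z zs)).
have cyz := real_comparable (rx y ys) (rx z (sub z zs)).
rewrite big_cons eqz.
case: (comparable_leP cyz) => [yz|zy].
  exists y => //; split=> // t; rewrite !inE => /or3P[/eqP->|/eqP->|ts] //.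
    by apply: le_trans yz _; apply: lez; rewrite mem_head.
  by apply: le_trans yz _; apply: lez; rewrite inE ts orbT.
exists z; first exact: sub.
split=> // t; rewrite !inE => /or3P[/eqP->|/eqP->|ts].
- by apply: lez; rewrite mem_head.
- exact: ltW.
- by apply: lez; rewrite inE ts orbT.
Qed.

Definition bit_subset (R : realType) (m : nat) (chi : {fset R[i]})
    (label : m.-tuple bool -> chi) (i : 'I_m) (b : bool) : {set chi} :=
  label @: [set w : m.-tuple bool | tnth w i == b].

Lemma bit_subset_neq0 (R : realType) (m : nat) (chi : {fset R[i]})
    (label : m.-tuple bool -> chi) (i : 'I_m) (b : bool) :
  bit_subset label i b != set0.
Proof.
apply/set0Pn; exists (label [tuple b | _ < m]).
by apply: imset_f; rewrite inE tnth_mktuple.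
Qed.

(* Indices are 0-based: lambda k is the (k+1)-st largest
   singular value, and only the values with k < minn M N matter. *)
Definition singular_mx (R : realType) (M N : nat) (lambda : nat -> R) :
    'M[R[i]]_(M, N) :=
  \matrix_(i < M, j < N) (if i == j :> nat then (lambda i)%:C else 0).

Definition first_cols (R : realType) (N S : nat) (hSN : (S <= N)%N)
    (V : 'M[R[i]]_N) : 'M[R[i]]_(N, S) :=
  colsub (widen_ord hSN) V.

Definition bicmb_metric (R : realType) (M S m : nat) (hSM : (S <= M)%N)
    (U : 'M[R[i]]_M) (lambda : nat -> R) (chi : {fset R[i]})
    (label : m.-tuple bool -> chi)
    (y : 'cV[R[i]]_M) (s : 'I_S) (i : 'I_m) (b : bool) : R[i] :=
  let r := (U^t* *m y) (widen_ord hSM s) 0 in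
  min_over (bit_subset label i b)
    (fun x : chi => `|r - (lambda s)%:C * val x| ^+ 2).

Definition mmse_detector (R : realType) (M N S : nat) (H : 'M[R[i]]_(M, N))
    (VL : 'M[R[i]]_(N, S)) (sigma2 : R) : 'M[R[i]]_(S, M) :=
  invmx ((H *m VL)^t* *m (H *m VL) + (sigma2%:C)%:M) *m (H *m VL)^t*.

Definition mmse_W (R : realType) (M N S : nat) (H : 'M[R[i]]_(M, N))
    (VL : 'M[R[i]]_(N, S)) (sigma2 : R) : 'M[R[i]]_S :=
  invmx (1%:M + sigma2%:C *: invmx ((H *m VL)^t* *m (H *m VL))).

Definition mmse_metric (R : realType) (M N S m : nat) (H : 'M[R[i]]_(M, N))
    (VL : 'M[R[i]]_(N, S)) (sigma2 : R) (chi : {fset R[i]})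
    (label : m.-tuple bool -> chi)
    (y : 'cV[R[i]]_M) (s : 'I_S) (i : 'I_m) (b : bool) : R[i] :=
  let r := (mmse_detector H VL sigma2 *m y) s 0 in
  let w := mmse_W H VL sigma2 s s in
  min_over (bit_subset label i b)
    (fun x : chi => w / (1 - w) * `|r / w - val x| ^+ 2).

Lemma mmse_W_real (R : realType) (M N S : nat) (H : 'M[R[i]]_(M, N))
    (VL : 'M[R[i]]_(N, S)) (sigma2 : R) (s : 'I_S) :
  mmse_W H VL sigma2 s s \is Num.real.
Proof.
have inv_herm (A : 'M[R[i]]_S) : A^t* = A -> (invmx A)^t* = invmx A.
  by move=> hA; rewrite trmx_inv map_invmx hA.
have W_herm : (mmse_W H VL sigma2)^t* = mmse_W H VL sigma2.
  apply/inv_herm; rewrite linearD /= map_mxD trmx1 map_mx1 linearZ /= map_mxZ.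
  rewrite inv_herm; last by rewrite trmx_mul map_mxM trmxCK.
  congr (_ + _ *: _); apply: conj_Creal.
  by rewrite complex_real.
apply/CrealP.
by rewrite -[RHS]/(mmse_W H VL sigma2 s s) -[in RHS]W_herm !mxE.
Qed.

(* Main.v *)
Require Import Defs.
From mathcomp Require Import all_boot all_order all_algebra.
From mathcomp Require Import finmap complex reals.
From mathcomp Require Import ring.

Import Order.TTheory GRing.Theory Num.Theory.

Local Open Scope ring_scope.
Local Open Scope complex_scope.
Local Open Scope sesquilinear_scope.

(** With perfect channel knowledge the effective channel is [U *m P], where
[P] consists of the first [S] columns of the singular value matrix.  Its Gram
matrix is diagonal with entries [lambda s ^+ 2], hence
[W s s = lambda s ^+ 2 / (lambda s ^+ 2 + sigma2)], the MMSE output divided by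
[W s s] is [r' / lambda s], and each term of the MMSE minimum is
[lambda s ^+ 2 / sigma2 * `|r' / lambda s - x| ^+ 2], i.e. [sigma2^-1] times
the corresponding BICMB term. *)

Lemma eq_min_over (R : realType) (T : finType) (A : {set T})
    (f g : T -> R[i]) : f =1 g -> min_over A f = min_over A g.
Proof.
rewrite /min_over => fg; case: (enum A) => [//|x s].
by rewrite fg; apply: eq_bigr.
Qed.

(** [Order.min] is decided by a test [a < b], whose outcome a positive factor preserves, even on
    non-real values. On the empty set, the dummy value 0 absorbs [c]. *)
Lemma min_over_pMl (R : realType) (T : finType) (A : {set T})
    (f : T -> R[i]) (c : R[i]) :
  0 < c -> min_over A (fun x => c * f x) = c * min_over A f.
Proof.
move=> c0; rewrite /min_over; case: (enum A) => [|x s]; first by rewrite mulr0.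
apply/esym/(big_morph ( *%R c)) => // a b.
by rewrite /Order.min ltr_pM2l //; case: ifP.
Qed.

Lemma invmx_diag (F : fieldType) (n : nat) (d : 'rV[F]_n) :
  (forall j, d 0 j != 0) -> invmx (diag_mx d) = diag_mx (\row_j (d 0 j)^-1).
Proof.
move=> d0; have dV : diag_mx d *m diag_mx (\row_j (d 0 j)^-1) = 1%:M.
  rewrite mulmx_diag -diag_const_mx; congr diag_mx.
  by apply/rowP => j; rewrite !mxE mulfV.
have [du _] := mulmx1_unit dV.
by rewrite -[LHS]mulmx1 -dV mulKmx.
Qed.

Definition singular_cols (R : realType) (M N S : nat) (hSN : (S <= N)%N)
    (lambda : nat -> R) : 'M[R[i]]_(M, S) :=
  colsub (widen_ord hSN) (singular_mx M N lambda).

Arguments singular_cols {R} M {N S} hSN lambda.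

(** Since [V^t* *m V] is the identity, [V^t*] times the first columns of [V] is a column selection
    of the identity, which extracts the same columns of the singular value matrix. *)
Lemma svd_mul_first_cols (R : realType) (M N S : nat) (hSN : (S <= N)%N)
    (U : 'M[R[i]]_M) (V : 'M[R[i]]_N) (lambda : nat -> R) :
  V \is unitarymx ->
  U *m singular_mx M N lambda *m V^t* *m first_cols hSN V =
  U *m singular_cols M hSN lambda.
Proof.
move=> /unitarymxP/mulmx1C VV.
by rewrite -mulmxA mulmx_colsub VV mulmx_colsub mulmx1 -mulmx_colsub.
Qed.

(** Row [s] of the adjoint can be nonzero only in column [s]. This serves both for the Gram matrix
    and for the detector output, where [A] is [U^t* *m y]. *)
Lemma trC_singular_cols_mul (R : realType) (M N S p : nat) (hSN : (S <= N)%N)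
    (hSM : (S <= M)%N) (lambda : nat -> R) (A : 'M[R[i]]_(M, p))
    (s : 'I_S) (j : 'I_p) :
  ((singular_cols M hSN lambda)^t* *m A) s j =
  (lambda s)%:C * A (widen_ord hSM s) j.
Proof.
rewrite mxE (bigD1 (widen_ord hSM s)) //= big1 ?addr0.
  by rewrite !mxE eqxx conj_Creal ?complex_real.
move=> k ks; rewrite !mxE /= -val_eqE /= in ks *.
by rewrite (negPf ks) conjC0 mul0r.
Qed.

Lemma gram_singular_cols (R : realType) (M N S : nat) (hSN : (S <= N)%N)
    (lambda : nat -> R) : (S <= M)%N ->
  (singular_cols M hSN lambda)^t* *m singular_cols M hSN lambda =
  diag_mx (\row_(s < S) (lambda s)%:C ^+ 2).
Proof.
move=> hSM; apply/matrixP => s t.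
rewrite (trC_singular_cols_mul _ _ _ _ _ _ hSM) !mxE /= -val_eqE /=.
by case: eqP => [->|_]; rewrite ?mulr1n ?mulr0n ?mulr0 ?expr2.
Qed.

(** Pulling [l^-1] out of the modulus produces [l ^- 2], which cancels the [l ^+ 2] in
    [w / (1 - w) = l ^+ 2 / sg]. *)
Lemma mmse_term_eq (C : numFieldType) (l sg r x : C) :
  0 < l -> 0 < sg ->
  let w := l ^+ 2 / (l ^+ 2 + sg) in
  w / (1 - w) * `|l / (l ^+ 2 + sg) * r / w - x| ^+ 2 =
  sg^-1 * `|r - l * x| ^+ 2.
Proof.
move=> l_gt0 sg_gt0 w.
have l_neq0 := lt0r_neq0 l_gt0; have sg_neq0 := lt0r_neq0 sg_gt0.
have d_neq0 : l ^+ 2 + sg != 0 by rewrite lt0r_neq0 // addr_gt0 ?exprn_gt0.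
have -> : l / (l ^+ 2 + sg) * r / w - x = l^-1 * (r - l * x).
  by rewrite /w; field; rewrite l_neq0 d_neq0.
have -> : w / (1 - w) = l ^+ 2 / sg.
  have -> : 1 - w = sg / (l ^+ 2 + sg) by rewrite /w; field.
  by rewrite /w; field; rewrite sg_neq0 d_neq0.
rewrite normrM exprMn normfV (gtr0_norm l_gt0).
by field; rewrite l_neq0 sg_neq0.
Qed.

Theorem mainTheorem3 (R : realType) (M N S m : nat)
  (H : 'M[R[i]]_(M, N)) (U : 'M[R[i]]_M) (V : 'M[R[i]]_N) (lambda : nat -> R)
  (sigma2 : R) (chi : {fset R[i]}) (label : m.-tuple bool -> chi)
  (hU : U \is unitarymx) (hV : V \is unitarymx)
  (hH : H = U *m singular_mx M N lambda *m V^t*)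
  (hlambda_ge0 : forall k : nat, (k < minn M N)%N -> 0 <= lambda k)
  (hlambda_anti : forall k l : nat,
     (k <= l)%N -> (l < minn M N)%N -> lambda l <= lambda k)
  (hS : (1 <= S)%N) (hSN : (S <= N)%N) (hSM : (S <= M)%N)
  (hlambdaS : 0 < lambda S.-1) (hsigma2 : 0 < sigma2)
  (hchi : #|` chi| = (2 ^ m)%N) (hlabel : bijective label) :
  exists2 c : R, 0 < c &
    forall (y : 'cV[R[i]]_M) (s : 'I_S) (i : 'I_m) (b : bool),
      mmse_metric H (first_cols hSN V) sigma2 label y s i b =
      c%:C * bicmb_metric hSM U lambda label y s i b.
Proof.
(* With 0-based indices, [lambda S.-1] is the smallest of the [S] singular values in use. *)
have lam_gt0 (k : 'I_S) : 0 < (lambda k)%:C.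
  rewrite ltcR; apply: lt_le_trans hlambdaS (hlambda_anti _ _ _ _).
    by rewrite -ltnS prednK.
  by rewrite prednK // leq_min hSM.
have sig_gt0 : 0 < sigma2%:C by rewrite ltcR.
have den_gt0 (k : 'I_S) : 0 < (lambda k)%:C ^+ 2 + sigma2%:C.
  by rewrite addr_gt0 ?exprn_gt0.
set P := singular_cols M hSN lambda.
have HV : H *m first_cols hSN V = U *m P by rewrite hH svd_mul_first_cols.
have trHV : (U *m P)^t* = P^t* *m U^t* by rewrite trmx_mul map_mxM.
have gram : (U *m P)^t* *m (U *m P) = diag_mx (\row_(k < S) (lambda k)%:C ^+ 2).
  have UU := mulmx1C (unitarymxP hU).
  by rewrite trHV -mulmxA (mulmxA (U^t*)) UU mul1mx gram_singular_cols.
(* The regularized Gram matrix is diagonal, so its inverse merely rescales each stream of the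
   matched filter output [P^t* *m (U^t* *m y)]. *)
have detE y s : (mmse_detector H (first_cols hSN V) sigma2 *m y) s 0 =
    (lambda s)%:C / ((lambda s)%:C ^+ 2 + sigma2%:C) *
    (U^t* *m y) (widen_ord hSM s) 0.
  rewrite /mmse_detector HV gram -diag_const_mx -raddfD /= invmx_diag.
    rewrite trHV -!mulmxA mul_diag_mx mxE (trC_singular_cols_mul _ _ _ _ _ _ hSM).
    by rewrite !mxE mulrA [_ * (lambda s)%:C]mulrC.
  by move=> j; rewrite !mxE gt_eqF.
(* Both inversions act on diagonal matrices; the outer one has the positive entries
   [1 + sigma2 / lambda s ^+ 2]. *)
have WE s : mmse_W H (first_cols hSN V) sigma2 s s =
    (lambda s)%:C ^+ 2 / ((lambda s)%:C ^+ 2 + sigma2%:C).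
  rewrite /mmse_W HV gram invmx_diag; last first.
    by move=> j; rewrite !mxE gt_eqF ?exprn_gt0.
  rewrite -linearZ /= -diag_const_mx -raddfD /= invmx_diag.
    rewrite !mxE eqxx mulr1n.
    by field; rewrite (lt0r_neq0 (den_gt0 s)) (lt0r_neq0 (lam_gt0 s)).
  move=> j; rewrite !mxE gt_eqF // addr_gt0 ?mulr_gt0 ?invr_gt0 ?exprn_gt0 //.
exists sigma2^-1; first by rewrite invr_gt0.
move=> y s i b; rewrite /mmse_metric /bicmb_metric detE WE.
rewrite -min_over_pMl; last by rewrite ltcR invr_gt0.
apply: eq_min_over => x /=.
rewrite fmorphV; exact: mmse_term_eq.
Qed.
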